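(* Let $\omega\in\Omega$, $l\in[n]\setminus\{\pi(\omega)\}$ and $\xi_1\in\{y_{\min},\dots,y_{\max}\}$. Then the inequality $$\theta_\omega\;\geq\;\sum_{\xi_2=y_{\min}}^{y_{\max}}W^\omega_{\pi(\omega)l}(\xi_1,\xi_2)\,z_{l\xi_2}(y)\;-\;\sum_{\xi'=\xi_1+1}^{y_{\max}}\ \max_{\xi_2\in\{y_{\min},\dots,y_{\max}\}}\Bigl(W^\omega_{\pi(\omega)l}(\xi_1,\xi_2)-W^\omega_{\pi(\omega)l}(\xi',\xi_2)\Bigr)z_{\pi(\omega)\xi'}(y)$$ is valid for the master problem; that is, for every $y\in Y$, the value $f_\omega(y)$ is at least the right-hand side, where $z_{j\xi}(y)=1$ if $y_j=\xi$ and $z_{j\xi}(y)=0$ otherwise.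
   Context: Let $n$ be a positive integer, $[n]=\{1,\dots,n\}$, and let $y_{\min}\le y_{\max}$ be non-negative integers. The problem considered is $$\min_y\ g(y)+\sum_{\omega\in\Omega}f_\omega(y)\quad\text{subject to } y\in Y,$$ where $\Omega$ is a finite set, $Y\subseteq\{y_{\min},\dots,y_{\max}\}^n\subseteq\mathbb{Z}_+^n$ is a finite set, $g:\mathbb{Z}_+^n\to\mathbb{R}$ is a function, and for each $\omega\in\Omega$, $f_\omega:\mathbb{Z}_+^n\to\mathbb{R}_+$ is a bounded function that is non-increasing in each of the variables ($\mathbb{Z}_+$, $\mathbb{R}_+$ denote the non-negative integers and reals). A function $\pi:\Omega\to[n]$ is given. In the master problem, each $f_\omega(y)$ is replaced by a continuous variable $\theta_\omega$, and binary variables $z_{j\xi}$ ($j\in[n]$, $\xi\in\{y_{\min},\dots,y_{\max}\}$) are introduced with $z_{j\xi}=1$ if and only if $y_j=\xi$, via the constraints $\sum_{\xi} z_{j\xi}=1$ and $\sum_\xi \xi z_{j\xi}=y_j$ for all $j\in[n]$. For $y\in\mathbb{Z}_+^n$ and $\mathcal{L}\subseteq[n]$, $\Delta(\mathcal{L},y)\in\mathbb{Z}_+^n$ denotes the vector obtained from $y$ by replacing $y_j$ by $y_{\max}$ for all $j\in[n]\setminus\mathcal{L}$. For distinct $k,l\in[n]$ and $\xi_1,\xi_2\in\{y_{\min},\dots,y_{\max}\}$, with $e_j$ the $j$th standard basis vector, $$W^\omega_{kl}(\xi_1,\xi_2)=f_\omega\bigl(\Delta(\{k,l\},\xi_1e_k+\xi_2e_l)\bigr),$$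 i.e. the value of $f_\omega$ when coordinate $k$ is $\xi_1$, coordinate $l$ is $\xi_2$, and all other coordinates are $y_{\max}$. Empty sums are zero. *)

(* Defs.v *)
From mathcomp Require Import all_boot all_order all_algebra.
From mathcomp Require Import finmap reals.

Set Implicit Arguments.
Unset Strict Implicit.
Unset Printing Implicit Defensive.

Import Order.TTheory GRing.Theory Num.Theory.
Local Open Scope ring_scope.

(* Z_+^n; the index set [n] is rendered as 'I_n, i.e. {0, .., n-1}. *)
Notation point n := {ffun 'I_n -> nat}.

Definition nonincreasing_in_each (R : realType) (n : nat) (f : point n -> R)
    : Prop :=
  forall (j : 'I_n) (y y' : point n),
    (forall i : 'I_n, i != j -> y i = y' i) -> (y j <= y' j)%N -> f y' <= f y.

Definition bounded_real_fun (R : realType) (n : nat) (f : point n -> R)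
    : Prop :=
  exists M : R, forall y : point n, `|f y| <= M.

Definition std_basis (n : nat) (j : 'I_n) : point n := [ffun i => (i == j : nat)].

Definition Delta (n ymax : nat) (L : {set 'I_n}) (y : point n) : point n :=
  [ffun j => if j \in L then y j else ymax].

(* [*+] and [+] are the pointwise
   operations of the additive monoid of finite functions into nat. *)
Definition W (R : realType) (n ymax : nat) (f : point n -> R) (k l : 'I_n)
    (xi1 xi2 : nat) : R :=
  f (Delta ymax [set k; l] (std_basis k *+ xi1 + std_basis l *+ xi2)).

Definition zval (R : realType) (n : nat) (y : point n) (j : 'I_n) (xi : nat)
    : R :=
  (y j == xi)%:R.

(* max_{a <= xi <= b} F xi for a <= b: the default value [F a] of the iterated
   maximum belongs to the range, so it does not affect the result. *)
Definition max_range (R : realType) (a b : nat) (F : nat -> R) : R :=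
  \big[Num.max/F a]_(a <= xi < b.+1) F xi.

(* Main.v *)
Require Import Defs.
From mathcomp Require Import all_boot all_order all_algebra.
From mathcomp Require Import finmap reals.

Set Implicit Arguments.
Unset Strict Implicit.
Unset Printing Implicit Defensive.

Import Order.TTheory GRing.Theory Num.Theory.
Local Open Scope ring_scope.

(** Write k for [pi w] and think of [W _ _ k l a b] as the value of [f w] at the
    point with coordinate k equal to a, coordinate l equal to b, and every other
    coordinate raised to [ymax].  Raising the coordinates of a feasible y
    outside of k and l can only decrease [f w], so W at (y k, y l) is a lower
    bound of [f w y] ([W_le]).  At y, each sum of the inequality has at most one
    nonzero term ([sum_zval]): the first one is W at (xi1, y l).  If y k exceeds
    xi1, then the second one is a maximum over xi2 which, taken at xi2 = y l, is
    at least the loss incurred by replacing xi1 by y k; subtracting it leaves at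
    most W at (y k, y l).  Otherwise the second sum vanishes, and W at
    (xi1, y l) is at most [f w y] because xi1 is at least y k. *)

(** The coordinates of [y] are replaced by those of [y'] one after the other;
    the monotonicity in a single variable applies to each replacement. *)
Lemma nonincreasing_pointwise (R : realType) (n : nat) (f : point n -> R)
    (y y' : point n) :
  nonincreasing_in_each f -> (forall i, y i <= y' i)%N -> f y' <= f y.
Proof.
move=> f_noninc le_yy'.
pose hybrid (s : seq 'I_n) : point n :=
  [ffun i => if i \in s then y' i else y i].
have hybrid_le s : f (hybrid s) <= f y.
  elim: s => [|j s IHs].
    by have -> : hybrid [::] = y by apply/ffunP => i; rewrite ffunE.
  apply: le_trans IHs; apply: (f_noninc j) => [i ij|].
    by rewrite !ffunE inE (negPf ij).
  by rewrite !ffunE mem_head; case: ifP.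
suff <- : hybrid (enum 'I_n) = y' by [].
by apply/ffunP => i; rewrite ffunE mem_enum.
Qed.

(** The point at which W evaluates [f] dominates [y]: it agrees with [y] at l,
    has a >= y k at k, and has [ymax] elsewhere.  The slack in the coordinate k
    lets a be either y k or a larger xi1, as the two cases of the theorem need. *)
Lemma W_le (R : realType) (n ymax : nat) (f : point n -> R) (k l : 'I_n)
    (a : nat) (y : point n) :
  nonincreasing_in_each f -> l != k -> (forall i, y i <= ymax)%N ->
  (y k <= a)%N -> W ymax f k l a (y l) <= f y.
Proof.
move=> f_noninc lk y_le yk_le; apply: nonincreasing_pointwise => // i.
rewrite /Delta ffunE !inE.
case: (eqVneq i k) => [->|ik] /=; last case: (eqVneq i l) => [->|il] //=.
- by rewrite ffunE !ffunMnE !ffunE eqxx eq_sym (negPf lk) mul0rn addr0 natn.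
- by rewrite ffunE !ffunMnE !ffunE eqxx (negPf lk) mul0rn add0r natn.
Qed.

Lemma sum_zval (R : realType) (n a b : nat) (F : nat -> R) (y : point n)
    (j : 'I_n) :
  \sum_(a <= xi < b) F xi * zval R y j xi =
    if (a <= y j < b)%N then F (y j) else 0.
Proof.
rewrite -(big_nat1_eq +%R) [RHS]big_mkcond; apply: eq_bigr => xi _.
by rewrite /zval eq_sym; case: eqP => _; rewrite ?mulr1 ?mulr0.
Qed.

Lemma max_range_ge (R : realType) (a b i : nat) (F : nat -> R) :
  (a <= i <= b)%N -> F i <= max_range a b F.
Proof.
by move=> ib; apply: le_bigmax_seq => //; rewrite mem_index_iota.
Qed.

Theorem mainTheorem4 (R : realType) (n ymin ymax : nat)
    (hn : (0 < n)%N) (hy : (ymin <= ymax)%N)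
    (Omega : finType)
    (Y : {fset point n})
    (hY : forall y : point n, y \in Y ->
       forall j : 'I_n, (ymin <= y j <= ymax)%N)
    (g : point n -> R)
    (f : Omega -> point n -> R)
    (f_ge0 : forall (w : Omega) (y : point n), 0 <= f w y)
    (f_bounded : forall w : Omega, bounded_real_fun (f w))
    (f_noninc : forall w : Omega, nonincreasing_in_each (f w))
    (pi : Omega -> 'I_n)
    (w : Omega) (l : 'I_n) (hl : l != pi w)
    (xi1 : nat) (hxi1 : (ymin <= xi1 <= ymax)%N) :
  forall y : point n, y \in Y ->
    f w y >=
      \sum_(ymin <= xi2 < ymax.+1)
         W ymax (f w) (pi w) l xi1 xi2 * zval R y l xi2
      - \sum_(xi1.+1 <= xi' < ymax.+1)
          max_range ymin ymax (fun xi2 : nat =>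
            W ymax (f w) (pi w) l xi1 xi2 - W ymax (f w) (pi w) l xi' xi2)
          * zval R y (pi w) xi'.
Proof.
move=> y yY.
have y_le i : (y i <= ymax)%N by case/andP: (hY _ yY i).
have W_lower a : (y (pi w) <= a)%N -> W ymax (f w) (pi w) l a (y l) <= f w y.
  exact: W_le.
rewrite !sum_zval !ltnS hY // y_le andbT.
case: ltnP => [_|yk_le]; last by rewrite subr0 W_lower.
apply: le_trans (W_lower _ (leqnn _)).
rewrite lerBlDr -lerBlDl; set F := (F in max_range _ _ F).
exact: (max_range_ge F (hY _ yY l)).
Qed.
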